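(* For integers $d\ge 2$ and $n\ge 2d$ let $\overline{cr}_d(K^d_n)$ denote the $d$-dimensional rectilinear crossing number of the complete $d$-uniform hypergraph $K^d_n$ with $n$ vertices. Then $\overline{cr}_d(K^d_n)=\Omega(2^d)\binom{n}{2d}$; that is, there exist a constant $C>0$ and an integer $d_0$ such that $\overline{cr}_d(K^d_n)\ge C\,2^d\binom{n}{2d}$ for all $d\ge d_0$ and all $n\ge 2d$.
   Context: The complete $d$-uniform hypergraph $K^d_n$ has $n$ vertices, and its hyperedges are all $d$-element subsets of the vertex set. Points in $\mathbb{R}^d$ are in general position if no $d+1$ of them lie on a common hyperplane. A $d$-dimensional rectilinear drawing of a $d$-uniform hypergraph with $n\ge 2d$ vertices places the vertices at points in general position in $\mathbb{R}^d$ and draws each hyperedge as the $(d-1)$-simplex that is the convex hull of its $d$ vertices. Two hyperedges form a crossing pair if they are vertex-disjoint and the corresponding simplices have a common point in their relative interiors. Pairs of hyperedges are unordered. The $d$-dimensional rectilinear crossing number of a $d$-uniform hypergraph is the minimum number of crossing pairs of hyperedges over all its $d$-dimensional rectilinear drawings. *)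

(* Defs.v *)
From HB Require Import structures.
From mathcomp Require Import all_boot all_order all_algebra.
From mathcomp Require Import boolp classical_sets reals topology normedtype convex.

Set Implicit Arguments.
Unset Strict Implicit.
Unset Printing Implicit Defensive.

Import Order.TTheory GRing.Theory Num.Theory.
Import numFieldNormedType.Exports.
Local Open Scope ring_scope.

Section Hulls.
Variable R : realType.

Definition convex_hull (M : lmodType R) (A : set M) : set M :=
  smallest (@convex_set R M) A.

Definition affine_set (M : lmodType R) (A : set M) : Prop :=
  forall x y (t : R), A x -> A y -> A (t *: x + (1 - t) *: y).

Definition affine_hull (M : lmodType R) (A : set M) : set M :=
  smallest (@affine_set M) A.

(* The interior of A for the topology induced on its affine hull. *)
Definition relative_interior (d : nat) (A : set 'rV[R]_d) : set 'rV[R]_d :=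
  [set x | A x /\ within (affine_hull A) (nbhs x) A]%classic.

Definition hyperplane (d : nat) (a : 'rV[R]_d) (b : R) : set 'rV[R]_d :=
  [set x | \sum_(j < d) a 0 j * x 0 j = b]%classic.

End Hulls.

(* A hypergraph on the finite vertex type V is given by its set of hyperedges,
   and a drawing by the positions p of the vertices. *)
Section Drawings.
Variables (R : realType) (d : nat) (V : finType).
Implicit Types (p : V -> 'rV[R]_d) (e f : {set V}) (H : {set {set V}}).

(* As soon as there are more than d vertices, and d > 0, this forces p to be
   injective. *)
Definition general_position p : Prop :=
  forall S : {set V}, #|S| = d.+1 ->
    ~ exists a b, a != 0 /\ forall v, v \in S -> hyperplane a b (p v).

Definition simplex p e : set 'rV[R]_d := convex_hull (p @` [set` e])%classic.

Definition crossing p e f : Prop :=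
  [disjoint e & f] /\
  (relative_interior (simplex p e) `&` relative_interior (simplex p f)
     !=set0)%classic.

(* A pair is encoded by the set [set e; f], so that it is unordered. *)
Definition crossing_pairs p H : {set {set {set V}}} :=
  [set P : {set {set V}} |
     `[< exists e f, [/\ e \in H, f \in H, P = [set e; f]%SET
                       & crossing p e f] >]]%SET.

Definition has_drawing H (k : nat) : Prop :=
  exists p, general_position p /\ #|crossing_pairs p H| = k.

(* Points on the moment curve are in general position. *)
Lemma general_position_exists : exists p, general_position p.
Proof.
pose t (v : V) : R := (enum_rank v)%:R.
exists (fun v => \row_(j < d) t v ^+ j.+1) => S cardS [a [b [a0 abS]]].
pose Q : {poly R} := rVpoly a * 'X - b%:P.
have tI : injective t.
  move=> v w /eqP; rewrite /t eqr_nat => /eqP vw.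
  exact/enum_rank_inj/val_inj.
have szQ : (size Q <= d.+1)%N.
  rewrite (leq_trans (size_polyD _ _))// size_polyN geq_max.
  rewrite (leq_trans (size_polyC_leq1 b))// andbT.
  by rewrite (leq_trans (size_polyMleq _ _))// size_polyX addn2 ltnS size_poly.
have Q0 : Q != 0.
  apply: contra a0 => /eqP Q0; apply/eqP.
  rewrite -[a]rVpolyK [rVpoly a](_ : _ = 0) ?linear0//.
  apply/polyP => i; have := congr1 (fun q : {poly R} => q`_i.+1) Q0.
  by rewrite /Q coefB coefMX coefC/= subr0 !coef0.
have rootQ : all (root Q) (map t (enum S)).
  apply/allP => x /mapP[v]; rewrite mem_enum => vS ->.
  have := abS v vS; rewrite /hyperplane/= => abv.
  rewrite /root /Q !hornerE subr_eq0 -[X in _ == X]abv; apply/eqP.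
  rewrite /rVpoly horner_poly mulr_suml; apply: eq_bigr => j _.
  by rewrite mxE valK exprSr mulrA.
have := max_poly_roots Q0 rootQ; rewrite map_inj_uniq// enum_uniq.
move=> /(_ isT); rewrite size_map -cardE cardS => /leq_trans /(_ szQ).
by rewrite ltnn.
Qed.

Lemma has_drawing_ex H : exists k, `[< has_drawing H k >].
Proof.
have [p gp] := general_position_exists.
by exists #|crossing_pairs p H|; apply/asboolP; exists p.
Qed.

Definition rectilinear_crossing_number H : nat := ex_minn (has_drawing_ex H).

End Drawings.

Arguments rectilinear_crossing_number R d {V} H.

Definition complete_hypergraph (d n : nat) : {set {set 'I_n}} :=
  [set e : {set 'I_n} | #|e| == d]%SET.

(* Main.v *)
Require Import Defs.
From mathcomp Require Import boolp classical_sets topology normedtype convex.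
From mathcomp Require Import all_boot all_order all_algebra.
From mathcomp Require Import zify ring lra interval_inference.
From mathcomp Require Import reals.

(** A crossing pair consists of 2d distinct vertices, so it is enough to find
    a constant times 2^d crossing pairs among any 2d points in general
    position ([crossings_on_subset]) and to sum over the 2d-subsets of the
    vertices ([card_crossing_pairs]).

    Fix 2d points in general position.  Their affine dependences l, with
    \sum_v l v = 0 and \sum_v l v *: p v = 0, form a space of dimension d - 1
    in which every set of d - 1 coordinates is a coordinate system
    ([dependence_eq0], [dependence_extend]).  A dependence positive on a d-set
    e and negative on its complement is, after scaling, a common point of the
    relative interiors of the simplices on e and on the complement
    ([dependence_crossing]).  So one counts the sign patterns, with d signs of
    each kind, of the dependences without zeros.

    For every set S of d - 3 vertices there is a dependence whose zeros are
    exactly S and whose other d + 3 signs are split as evenly as parity allows: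
    the dependences vanishing on S form a plane, and along a line in this plane
    the number of positive signs changes by at most one at a time, while
    its values at the two ends are nearly complementary
    ([halving_dependence]).  A small perturbation gives arbitrary signs on S
    ([perturb_dependence]), so S alone accounts for about
    'C(d - 3, (d - 3) / 2) balanced sign patterns, which is of the order of
    2^d / sqrt d ([middle_bin_ge]).

    The missing factor sqrt d comes from using about m = sqrt d sets S.  A
    pattern obtained from both S and S' is determined by its signs on
    S :&: S', so two sets share at most 2^(#|S :&: S'|) patterns
    ([card_completionsI]).  Taking for the S intervals of length d - 3 shifted
    by multiples of m makes these overlaps at most 2^(d - 3 - m), negligible
    against 2^d / sqrt d, and the union has size of order 2^d
    ([many_completions]). *)

Set Implicit Arguments.
Unset Strict Implicit.
Unset Printing Implicit Defensive.
Import Order.TTheory GRing.Theory Num.Theory.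
Import numFieldNormedType.Exports.

(** * Binomial estimates *)

(** The squared form of the bound 'C(2k, k) >= 4^k / (2 sqrt k), which makes
    the induction step the inequality 4k(k+1) <= (2k+1)^2. *)
Lemma central_bin_sqr k :
  (0 < k -> 16 ^ k <= 4 * k * 'C(2 * k, k) ^ 2)%N.
Proof.
elim: k => // -[_ _|k IHk _]; first by [].
set n := k.+1 in IHk *.
have binS : (n.+1 * 'C(2 * n.+1, n.+1) = 2 * (2 * n).+1 * 'C(2 * n, n))%N.
  have -> : (2 * n.+1 = (2 * n).+2)%N by lia.
  rewrite -mul_bin_diag.
  have := mul_bin_down (2 * n).+1 n => /=.
  have -> : ((2 * n).+1 - n = n.+1)%N by lia.
  nia.
rewrite -(leq_pmul2l (ltn0Sn n)) expnS.
have -> : (n.+1 * (4 * n.+1 * 'C(2 * n.+1, n.+1) ^ 2)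
           = 4 * (n.+1 * 'C(2 * n.+1, n.+1)) ^ 2)%N by ring.
rewrite binS.
have := IHk isT; move: (16 ^ n)%N ('C(2 * n, n)) => a c le_a.
apply: (@leq_trans (n.+1 * (16 * (4 * n * c ^ 2)))); first by nia.
have -> : (4 * (2 * (2 * n).+1 * c) ^ 2 = 16 * (2 * n).+1 ^ 2 * c ^ 2)%N by ring.
have -> : (n.+1 * (16 * (4 * n * c ^ 2)) = 16 * (4 * n * n.+1) * c ^ 2)%N by ring.
rewrite leq_mul2r leq_mul2l; apply/orP; right; nia.
Qed.

Lemma middle_bin_ge n m :
  (0 < m -> n <= 2 * m ^ 2 -> 2 ^ n <= 4 * m * 'C(n, n./2))%N.
Proof.
move=> m0 nm; set k := n./2.
have nE : n = (odd n + 2 * k)%N by rewrite /k; lia.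
have bin_mono : ('C(2 * k, k) <= 'C(n, k))%N.
  by rewrite {1}nE leq_bin2l // ?leq_addl //; lia.
have pow_n : (2 ^ n <= 2 * 4 ^ k)%N.
  by rewrite nE expnD expnM leq_mul2r; case: (odd n); rewrite orbT.
have [k0|k0] := posnP k.
  by move: pow_n; rewrite k0 bin0 => pow_n; apply: leq_trans pow_n _; lia.
suff : (4 ^ k <= 2 * m * 'C(2 * k, k))%N by nia.
rewrite -leq_sqr -expnM mulnC expnM -[(4 ^ 2)%N]/16.
apply: leq_trans (central_bin_sqr k0) _.
rewrite !expnMn leq_mul2r -[(2 ^ 2)%N]/4; apply/orP; right; lia.
Qed.

(** * Unions of families of completions *)

(** Bonferroni's inequality, with the number of pairs bounded by m^2. *)
Lemma card_bigcup_ge (T : finType) (A : nat -> {set T}) (a b m : nat) :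
  (forall i, i < m -> a <= #|A i|) ->
  (forall i j, i < j -> j < m -> #|A i :&: A j| <= b) ->
  (m * a <= #|\bigcup_(i < m) A i| + m ^ 2 * b)%N.
Proof.
elim: m => [|m IHm] leA leI; first by rewrite mul0n.
have {}IHm := IHm (fun i im => leA i (ltnW im))
                  (fun i j ij jm => leI i j ij (ltnW jm)).
rewrite big_ord_recr /= cardsU big_distrl /=.
set I := \bigcup_(i < m) (A i :&: A m); set U := \bigcup_(i < m) A i in IHm *.
have cardI : (#|I| <= m * b)%N.
  rewrite -[X in (X * b)%N]card_ord -sum_nat_const.
  apply: (big_ind2 (fun (X : {set T}) x => #|X| <= x)%N) => [|X x Y y Xx Yy|i _].
  - by rewrite cards0.
  - by rewrite cardsU (leq_trans (leq_subr _ _)) // leq_add.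
  - exact: leI.
have IA : (#|I| <= #|A m|)%N.
  by apply/subset_leq_card/bigcupsP => i _; exact: subsetIr.
have am := leA m (leqnn _).
rewrite mulSn [X in (_ <= _ + X)%N](_ : _ = m ^ 2 * b + (2 * m + 1) * b)%N; last by ring.
move: #|I| #|U| #|A m| (m * a)%N (m ^ 2 * b)%N IHm cardI IA am.
move=> i u c ma mb IHm cardI IA am; lia.
Qed.

Section Completions.
Variables (T : finType) (h : nat).
Implicit Types S U X : {set T}.

Definition completions S U :=
  [set U :|: X | X in [set X : {set T} | X \subset S & #|X| == h]].

(** Outside S a completion is U: this is what identifies a completion from a
    small part of it. *)
Lemma completion_trace S U X :
  [disjoint U & S] -> X \in completions S U -> X :\: S = U.
Proof.
rewrite -setI_eq0 => /eqP US0 /imsetP[Y]; rewrite inE => /andP[YS _] ->.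
rewrite setDUl (eqP (_ : Y :\: S == set0)) ?setD_eq0 // setU0 setDE.
by apply/setIidPl; rewrite -disjoints_subset -setI_eq0 US0.
Qed.

Lemma card_completions S U :
  [disjoint U & S] -> #|completions S U| = 'C(#|S|, h).
Proof.
move=> US; rewrite card_in_imset ?cards_draws // => X Y.
rewrite !inE => /andP[XS _] /andP[YS _] eqXY.
apply/setP => x; have := congr1 (fun A : {set T} => x \in A) eqXY; rewrite !inE.
have [xU|//] := boolP (x \in U).
move=> _; have xS : x \notin S by rewrite (disjointFr US).
by rewrite (contraNF (subsetP XS x) xS) (contraNF (subsetP YS x) xS).
Qed.

(** A common element is prescribed outside S and outside S', hence known once
    its trace on S :&: S' is. *)
Lemma card_completionsI S U S' U' :
  [disjoint U & S] -> [disjoint U' & S'] ->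
  (#|completions S U :&: completions S' U'| <= 2 ^ #|S :&: S'|)%N.
Proof.
move=> US US'; rewrite -card_powerset.
have inj : {in completions S U :&: completions S' U' &,
             injective (fun X => X :&: (S :&: S'))}.
  move=> X Y /setIP[XA XA'] /setIP[YA YA'] eqXY; apply/setP => x.
  have := completion_trace US XA; rewrite -(completion_trace US YA).
  move=> /setP/(_ x).
  have := completion_trace US' XA'; rewrite -(completion_trace US' YA').
  move=> /setP/(_ x).
  move/setP: eqXY => /(_ x); rewrite !inE.
  by case: (x \in S); case: (x \in S'); rewrite ?andbT //= => ? [].
rewrite -(card_in_imset inj); apply/subset_leq_card/subsetP => _ /imsetP[X _ ->].
by rewrite inE subsetIr.
Qed.

End Completions.

Definition ord_interval N a b : {set 'I_N} := [set x : 'I_N | a <= x < b].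

Lemma card_ord_interval N a b : b <= N -> #|ord_interval N a b| = b - a.
Proof.
move=> bN; rewrite -sum1_card (eq_bigl (fun x : 'I_N => a <= x < b)); last first.
  by move=> x; rewrite inE.
rewrite -(big_mkord (fun i => a <= i < b) (fun=> 1)).
rewrite -[RHS]muln1 -sum_nat_const_nat (big_nat_widen _ _ _ _ _ bN).
rewrite [RHS](big_nat_widenl a 0) //=.
by apply: eq_bigl => i; rewrite andbC.
Qed.

(** With m the integer part of sqrt d, the m intervals of length d - 3 that
    start at the multiples of m fit into 2d places, and any two of them share
    at most d - 3 - m places.  Each contributes at least 2^(d - 3) / (4 m)
    completions, and all overlaps together cost at most m^2 * 2^(d - 3 - m),
    which is at most half of the total 2^(d - 3) / 4 once 8 m^2 <= 2^m, that
    is from m = 10 on. *)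
Lemma many_completions d (good : {set {set 'I_(2 * d)}}) :
  100 <= d ->
  (forall S : {set 'I_(2 * d)}, #|S| = d - 3 ->
    exists2 U : {set 'I_(2 * d)}, [disjoint U & S]
      & completions (d - 3)./2 S U \subset good) ->
  2 ^ d <= 64 * #|good|.
Proof.
move=> d100 goodS.
have [m /andP[m_le m_gt]] : exists m, m ^ 2 <= d < m.+1 ^ 2.
  have ex : exists m, m ^ 2 <= d by exists 0.
  have bd : forall m, m ^ 2 <= d -> m <= d by move=> m; nia.
  case: (ex_maxnP ex bd) => m md max_m; exists m; rewrite md ltnNge.
  by apply/negP => /max_m; rewrite ltnn.
have m10 : 10 <= m by nia.
pose S i := ord_interval (2 * d) (i * m) (i * m + (d - 3)).
have cardS i : i < m -> #|S i| = d - 3.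
  move=> im; rewrite card_ord_interval; first by rewrite addKn.
  nia.
have cardSI i j : i < j -> j < m -> #|S i :&: S j| <= d - 3 - m.
  move=> ij jm.
  have : S i :&: S j \subset ord_interval (2 * d) (j * m) (i * m + (d - 3)).
    by apply/subsetP => x; rewrite !inE; lia.
  move=> /subset_leq_card /leq_trans; apply; rewrite card_ord_interval; nia.
have [U US] : exists U : nat -> {set 'I_(2 * d)}, forall i, i < m ->
    [disjoint U i & S i] /\ completions (d - 3)./2 (S i) (U i) \subset good.
  have ex i : exists U : {set 'I_(2 * d)}, (i < m) ==>
      ([disjoint U & S i] && (completions (d - 3)./2 (S i) U \subset good)).
    case: ltnP => [im|_]; last by exists set0.
    by have [U US UG] := goodS _ (cardS i im); exists U; rewrite US.
  exists (fun i => xchoose (ex i)) => i im.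
  by have /implyP/(_ im)/andP[] := xchooseP (ex i).
pose A i := completions (d - 3)./2 (S i) (U i).
have leG : #|\bigcup_(i < m) A i| <= #|good|.
  by apply/subset_leq_card/bigcupsP => i _; case: (US i (ltn_ord i)).
have cardA i : i < m -> 'C(d - 3, (d - 3)./2) <= #|A i|.
  by move=> im; rewrite card_completions ?cardS //; case: (US i im).
have cardAI i j : i < j -> j < m -> #|A i :&: A j| <= 2 ^ (d - 3 - m).
  move=> ij jm; have [Ui _] := US i (ltn_trans ij jm); have [Uj _] := US j jm.
  by rewrite (leq_trans (card_completionsI _ _ _)) // leq_exp2l // cardSI.
have leA := card_bigcup_ge cardA cardAI.
have leC : 2 ^ (d - 3) <= 4 * m * 'C(d - 3, (d - 3)./2).
  by apply: middle_bin_ge; nia.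
have pow_m : 8 * m ^ 2 <= 2 ^ m.
  rewrite -(subnK m10); elim: (m - 10) => // k IHk; rewrite addSn [X in _ <= X]expnS.
  nia.
have -> : 2 ^ d = 8 * 2 ^ (d - 3) by rewrite -(expnD 2 3); congr (2 ^ _); lia.
have : 2 ^ (d - 3) = 2 ^ (d - 3 - m) * 2 ^ m by rewrite -expnD; congr (2 ^ _); nia.
move: (2 ^ (d - 3)) (2 ^ (d - 3 - m)) (2 ^ m) 'C(_, _) pow_m leC leA.
move=> p q r c pow_m leC leA pE.
nia.
Qed.

Local Open Scope ring_scope.

(** * Affine dependences of points in general position *)

Section Dependences.
Variables (R : realType) (d : nat).

(** In homogeneous coordinates affine dependence becomes linear dependence. *)
Definition homog (x : 'rV[R]_d) : 'rV[R]_(1 + d) := row_mx (const_mx 1) x.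

Lemma homogEl x i : homog x 0 (lshift d i) = 1.
Proof. by rewrite row_mxEl mxE. Qed.

Lemma homogEr x j : homog x 0 (rshift 1 j) = x 0 j.
Proof. by rewrite row_mxEr. Qed.

(** The homogenized points of d + 1 vertices form a basis of the (1 + d)-space,
    since a linear form vanishing on all of them would be a hyperplane through
    the d + 1 points; K is the dual basis. *)
Lemma barycentric_basis (V : finType) (p : V -> 'rV[R]_d) (B : {set V}) :
  general_position p -> #|B| = d.+1 ->
  exists K : V -> 'cV[R]_(1 + d),
    (forall v w, v \in B -> w \in B -> (homog (p w) *m K v) 0 0 = (v == w)%:R) /\
    (forall z, \sum_(v in B) (z *m K v) 0 0 *: homog (p v) = z).
Proof.
move=> gp cardB.
pose M : 'M[R]_(#|B|, 1 + d) := \matrix_i homog (p (enum_val i)).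
(* A row in the kernel of the transpose of M reads (b, a), where b + <a, p w>
   vanishes for each w in B. *)
have rkM : \rank M = d.+1.
  apply/eqP; rewrite -mxrank_tr -[_ == _]/(row_free M^T) -kermx_eq0.
  apply/rowV0P => z /sub_kermxP zM0.
  have zw w : w \in B ->
      lsubmx z 0 0 + \sum_(j < d) rsubmx z 0 j * p w 0 j = 0.
    move=> wB; have := congr1 (fun A : 'rV_ _ => A 0 (enum_rank_in wB w)) zM0.
    rewrite [RHS]mxE [LHS]mxE big_split_ord /= big_ord1 => zw0.
    apply: etrans zw0; congr (_ + _).
      rewrite [lsubmx z 0 0]mxE [M^T _ _]mxE [M _ _]mxE.
      by rewrite enum_rankK_in // homogEl mulr1.
    apply: eq_bigr => j _; rewrite [rsubmx z 0 j]mxE [M^T _ _]mxE [M _ _]mxE.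
    by rewrite enum_rankK_in // homogEr.
  have a0 : rsubmx z = 0.
    apply/eqP/negPn/negP => a0; apply: (gp B cardB).
    exists (rsubmx z), (- lsubmx z 0 0); split=> // v vB.
    by apply/eqP; rewrite -addr_eq0 addrC zw.
  have [w wB] : exists w, w \in B by apply/card_gt0P; rewrite cardB.
  have b0 : lsubmx z = 0.
    apply/matrixP => i j; rewrite !ord1 [RHS]mxE -(zw w wB) a0 big1 ?addr0 // => k _.
    by rewrite mxE mul0r.
  by rewrite -[z]hsubmxK a0 b0 row_mx0.
have MK : M *m pinvmx M = 1%:M by apply: mulmxVp; rewrite /row_free rkM cardB.
have KM : pinvmx M *m M = 1%:M by apply: mulVpmx; rewrite /row_full rkM.
pose K v : 'cV[R]_(1 + d) :=
  if [pick i | enum_val i == v :> V] is Some i then col i (pinvmx M) else 0.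
have KE (i : 'I_#|B|) : K (enum_val i) = col i (pinvmx M).
  rewrite /K; case: pickP => [j /eqP/enum_val_inj -> //|/(_ i)].
  by rewrite eqxx.
exists K; split=> [v w vB wB|z].
  rewrite -(enum_rankK_in vB vB) -(enum_rankK_in wB wB) KE.
  set i := enum_rank_in vB v; set j := enum_rank_in wB w.
  have -> : homog (p (enum_val j)) = row j M by rewrite rowK.
  rewrite -[col i _]mulmx1 colE mulmx1 mulmxA -row_mul MK -colE !mxE.
  by rewrite (inj_eq enum_val_inj) eq_sym.
rewrite big_enum_val /=.
rewrite -[RHS]mulmx1 -KM mulmxA mulmx_sum_row; apply: eq_bigr => i _.
by rewrite KE rowK; congr (_ *: _); rewrite colE mulmxA -colE mxE.
Qed.

Definition dependence (V : finType) (p : V -> 'rV[R]_d) (l : V -> R) :=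
  \sum_v l v *: homog (p v) = 0.

Lemma dependence_comb (V : finType) (p : V -> 'rV[R]_d) (a b : R)
    (l l' : V -> R) :
  dependence p l -> dependence p l' ->
  dependence p (fun v => a * l v + b * l' v).
Proof.
rewrite /dependence => l0 l'0.
under eq_bigr do rewrite scalerDl -!scalerA.
by rewrite big_split /= -!scaler_sumr l0 l'0 !scaler0 addr0.
Qed.

Section TwiceD.
Variables (V : finType) (p : V -> 'rV[R]_d).
Hypotheses (gp : general_position p) (d0 : (0 < d)%N) (cardV : #|V| = (2 * d)%N).
Implicit Types (Z S : {set V}) (l : V -> R).

Lemma card_compl_pred Z : #|Z| = d.-1 -> #|~: Z| = d.+1.
Proof. by move=> cZ; have := cardsC Z; rewrite cZ cardV; lia. Qed.

(** A dependence vanishing on d - 1 of the 2d vertices lives on d + 1 vertices,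
    which are affinely independent. *)
Lemma dependence_eq0 Z l : #|Z| = d.-1 -> dependence p l ->
  (forall v, v \in Z -> l v = 0) -> forall v, l v = 0.
Proof.
move=> /card_compl_pred cB l0 lZ v.
have [K [KE _]] := barycentric_basis gp cB.
have [/lZ //|vZ] := boolP (v \in Z).
have := congr1 (fun A => (A *m K v) 0 0) l0.
rewrite mul0mx [RHS]mxE => lK; apply: etrans lK.
rewrite mulmx_suml summxE (bigD1 v) //= big1 ?addr0 => [|w wv].
  by rewrite -scalemxAl mxE KE ?inE // eqxx mulr1.
have [/lZ ->|wZ] := boolP (w \in Z); first by rewrite scale0r mul0mx mxE.
by rewrite -scalemxAl mxE KE ?inE // eq_sym (negPf wv) mulr0.
Qed.

(** The d + 1 vertices outside Z span, so they can compensate any prescribed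
    combination of the points of Z. *)
Lemma dependence_extend Z (f : V -> R) : #|Z| = d.-1 ->
  exists2 l, dependence p l & forall v, v \in Z -> l v = f v.
Proof.
move=> /card_compl_pred cB.
have [K [_ KS]] := barycentric_basis gp cB.
pose z := - \sum_(v in Z) f v *: homog (p v).
exists (fun v => if v \in Z then f v else (z *m K v) 0 0) => [|v -> //].
rewrite /dependence (bigID (mem Z)) /=.
rewrite (eq_bigr (fun v => f v *: homog (p v))) => [|v -> //].
rewrite [X in _ + X](_ : _ = z) ?subrr // -[RHS]KS.
apply: eq_big => v; first by rewrite inE.
by move=> /negPf ->.
Qed.

End TwiceD.
End Dependences.

(** * Balanced dependences *)

Lemma discrete_ivt (f : nat -> nat) (N h : nat) :
  (forall j, (j < N)%N -> (f j.+1 <= (f j).+1)%N /\ (f j <= (f j.+1).+1)%N) ->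
  (f 0 <= h <= f N)%N \/ (f N <= h <= f 0)%N ->
  exists2 j, (j <= N)%N & f j = h.
Proof.
elim: N => [|N IHN] step hf; first by exists 0%N => //; lia.
have [<-|fh] := eqVneq (f N.+1) h; first by exists N.+1.
have [||j jN <-] := IHN; last by exists j => //; exact: leqW.
- by move=> j jN; apply: step; exact: leqW.
- by have := step N (leqnn _); lia.
Qed.

Lemma exists_between (R : realFieldType) (s1 s2 : seq R) :
  {in s1 & s2, forall a b, a < b} ->
  exists t, {in s1, forall a, a < t} /\ {in s2, forall b, t < b}.
Proof.
have below (s : seq R) a : {in s, forall b, a < b} ->
    exists2 t, a < t & {in s, forall b : R, t < b}.
  elim: s => [_|b s IHs ab]; first by exists (a + 1) => //; rewrite ltrDl.
  have [|t at_ ts] := IHs; first by move=> c cs; apply: ab; rewrite inE cs orbT.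
  have {}ab := ab b (mem_head _ _).
  exists (Num.min t ((a + b) / 2)); first by rewrite lt_min at_; lra.
  move=> c; rewrite inE => /predU1P[->|/ts tc]; rewrite gt_min ?tc //.
  by apply/orP; right; lra.
elim: s1 => [_|a s1 IHs1 s12].
  suff [t ts] : exists t, {in s2, forall b, t < b} by exists t.
  elim: s2 => [|b s [t ts]]; first by exists 0.
  exists (Num.min t (b - 1)) => c; rewrite inE gt_min => /predU1P[->|/ts -> //].
  by apply/orP; right; lra.
have [|t [ts1 ts2]] := IHs1.
  by move=> b c bs cs; apply: s12 => //; rewrite inE bs orbT.
have [|u au us] := below s2 a; first by move=> b bs; apply: s12 => //; exact: mem_head.
exists (Num.max t u); split=> b; last first.
  by move=> bs; rewrite gt_max ts2 ?us.
by rewrite inE lt_max => /predU1P[->|/ts1 ->]; rewrite ?au ?orbT.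
Qed.

Section Halving.
Variables (R : realType) (d : nat) (V : finType) (p : V -> 'rV[R]_d).
Hypotheses (gp : general_position p) (d3 : (3 <= d)%N) (cardV : #|V| = (2 * d)%N).
Implicit Types (S X : {set V}) (l : V -> R).

Let d0 : (0 < d)%N. Proof. exact: ltn_trans d3. Qed.

Lemma card_setU2 S x y : #|S| = (d - 3)%N -> x \notin S -> y \notin S -> x != y ->
  #|x |: (y |: S)| = d.-1.
Proof.
by move=> cS xS yS xy; rewrite !cardsU1 !inE cS (negPf xS) yS (negPf xy) /=; lia.
Qed.

(** Choose x outside S, a dependence u vanishing on S with u x = 1, and a
    dependence w vanishing exactly on S and x.  Along the line u + t w the sign
    at x is constant, and each of the other d + 2 vertices e changes sign
    once, at tau e.  These times are distinct, as a dependence vanishing on S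
    and at two more vertices is zero.  So the number of positive signs moves by
    steps of one; its values for t near -oo and +oo add up to d + 4, hence it
    takes the value (d + 4) / 2, rounded down, in between. *)
Lemma halving_dependence S : #|S| = (d - 3)%N ->
  exists2 l, dependence p l &
    (forall v, (l v == 0) = (v \in S)) /\ #|[set v | 0 < l v]| = (d + 4)./2.
Proof.
move=> cS.
have cSC : #|~: S| = (d + 3)%N by have := cardsC S; rewrite cS cardV; lia.
have [x xS] : exists x, x \notin S.
  have /card_gt0P[x] : (0 < #|~: S|)%N by rewrite cSC; lia.
  by rewrite inE; exists x.
pose E := ~: (x |: S).
have cE : #|E| = d.+2.
  by have := cardsC (x |: S); rewrite cardsU1 xS cS cardV -/E; lia.
have [y yE] : exists y, y \in E by apply/card_gt0P; rewrite cE.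
have ES e : e \in E -> e \notin S by rewrite !inE negb_or => /andP[].
have Ex e : e \in E -> x != e by rewrite !inE negb_or eq_sym => /andP[].
have cT e : e \in E -> #|x |: (e |: S)| = d.-1.
  by move=> eE; apply: card_setU2 => //; [exact: ES|exact: Ex].
have [u du uT] := dependence_extend gp d0 cardV (fun v => (v == x)%:R) (cT y yE).
have [w dw wT] := dependence_extend gp d0 cardV (fun v => (v == y)%:R) (cT y yE).
have uS v : v \in S -> u v = 0.
  move=> vS; rewrite uT ?inE ?vS ?orbT //.
  by rewrite (negPf (contraTneq _ vS)) // => ->.
have wS v : v \in S -> w v = 0.
  move=> vS; rewrite wT ?inE ?vS ?orbT //.
  by rewrite (negPf (contraTneq _ vS)) // => ->; exact: ES.
have ux : u x = 1 by rewrite uT ?inE ?eqxx.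
have wx : w x = 0 by rewrite wT ?inE ?eqxx // (negPf (Ex y yE)).
have wE e : e \in E -> w e != 0.
  move=> eE; apply/eqP => we.
  have := dependence_eq0 gp d0 cardV (cT e eE) dw _ y.
  rewrite wT ?inE ?eqxx ?orbT // => w0; suff /eqP : 1%:R = 0 :> R by rewrite oner_eq0.
  by apply: w0 => v; rewrite !inE => /or3P[/eqP->|/eqP->|/wS].
pose tau e := - u e / w e.
pose l t v := 1 * u v + t * w v.
have dl t : dependence p (l t) by apply: dependence_comb.
have lE t e : e \in E -> l t e = w e * (t - tau e).
  by move=> eE; rewrite /l /tau; have := wE e eE => we; field.
have tau_inj : {in E &, injective tau}.
  move=> e f eE fE ef; apply/eqP/negPn/negP => nef.
  have := @dependence_eq0 _ _ _ _ gp d0 cardV _ _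
    (card_setU2 cS (ES _ eE) (ES _ fE) nef) (dl (tau e)) _ x.
  have -> : l (tau e) x = 1 by rewrite /l ux wx; ring.
  move=> l0; suff /eqP : 1%:R = 0 :> R by rewrite oner_eq0.
  apply: l0 => v; rewrite !inE => /or3P[/eqP->|/eqP->|vS].
  - by rewrite lE // subrr mulr0.
  - by rewrite lE // ef subrr mulr0.
  - by rewrite /l uS ?wS // !mulr0 addr0.
(* The vertices of E in the order in which they change sign. *)
pose s := sort (fun e f => tau e <= tau f) (enum E).
have sE e : (e \in s) = (e \in E) by rewrite mem_sort mem_enum.
have s_uniq : uniq s by rewrite sort_uniq enum_uniq.
have size_s : size s = d.+2 by rewrite size_sort -cardE.
have s_lt j : {in take j s & drop j s, forall e f, tau e < tau f}.
  move=> e f es fs.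
  have es' := mem_take es; have fs' := mem_drop fs.
  rewrite lt_neqAle; apply/andP; split.
    apply: contraTneq fs => /tau_inj ef.
    have {}ef : e = f by apply: ef; rewrite -sE.
    have : uniq (take j s ++ drop j s) by rewrite cat_take_drop.
    rewrite cat_uniq -ef => /and3P[_ /hasPn + _].
    by move=> nt; apply/negP => ed; have := nt e ed; rewrite /= es.
  have : sorted (fun e f => tau e <= tau f) s.
    by apply: sort_sorted => a b; exact: le_total.
  rewrite sorted_pairwise; last by move=> b a c; exact: le_trans.
  by rewrite -(cat_take_drop j s) pairwise_cat => /and3P[/allrelP/(_ _ _ es fs)].
(* The positive vertices once the first j vertices of s have changed sign. *)
pose U j := x |: [set e in E | (0 < w e) == (e \in take j s)].
have lU j : exists t, (forall v, (l t v == 0) = (v \in S)) /\ [set v | 0 < l t v] = U j.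
  have [|t [ts1 ts2]] := @exists_between R (map tau (take j s)) (map tau (drop j s)).
    by move=> a b /mapP[e es ->] /mapP[f fs ->]; exact: (s_lt j).
  have sgn e : e \in E ->
      (l t e != 0) && ((0 < l t e) == ((0 < w e) == (e \in take j s))).
    move=> eE; rewrite lE //; have we := wE e eE.
    have := eE; rewrite -sE -{1}(cat_take_drop j s) mem_cat.
    have [es _|es /= ds] := boolP (e \in take j s).
      have te : 0 < t - tau e by rewrite subr_gt0 ts1 // map_f.
      by rewrite mulf_neq0 ?(gt_eqF te) //= pmulr_lgt0 // eqb_id.
    have te : t - tau e < 0 by rewrite subr_lt0 ts2 // map_f.
    rewrite mulf_neq0 ?(lt_eqF te) //= nmulr_lgt0 // eqbF_neg -leNgt.
    by rewrite le_eqVlt (negPf we).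
  exists t; split=> [v|].
    have [vS|vS] := boolP (v \in S).
      by rewrite /l uS // wS // !mulr0 addr0 eqxx.
    have [->|vx] := eqVneq v x; first by rewrite /l ux wx mulr0 addr0 mulr1 oner_eq0.
    have vE : v \in E by rewrite !inE negb_or vx vS.
    by have /andP[/negPf-> _] := sgn v vE.
  apply/setP => v; rewrite !inE.
  have [->|vx] /= := eqVneq v x; first by rewrite /l ux wx mulr0 addr0 mulr1 ltr01.
  have [vS|vS] /= := boolP (v \in S); first by rewrite /l uS // wS // !mulr0 addr0 ltxx.
  have vE : v \in E by rewrite !inE negb_or vx vS.
  by have /andP[_ /eqP] := sgn v vE.
have [||j _ Uj] := @discrete_ivt (fun j => #|U j|) d.+2 (d + 4)./2.
- move=> j js; rewrite -size_s in js.
  have U1 : U j.+1 \subset nth x s j |: U j.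
    apply/subsetP => v; rewrite !inE (take_nth x js) mem_rcons inE.
    by case: (eqVneq v (nth x s j)) => _; rewrite ?orbT //=.
  have U2 : U j \subset nth x s j |: U j.+1.
    apply/subsetP => v; rewrite !inE (take_nth x js) mem_rcons inE.
    by case: (eqVneq v (nth x s j)) => _; rewrite ?orbT //=.
  move/subset_leq_card: U1; move/subset_leq_card: U2; rewrite !cardsU1.
  by case: (_ \notin _); case: (_ \notin _); lia.
- have : (#|U 0| + #|U d.+2| = d + 4)%N.
    pose P := [set e | 0 < w e].
    have -> : U 0%N = x |: E :\: P.
      by apply/setP => v; rewrite !inE take0 eqbF_neg andbC.
    have -> : U d.+2 = x |: E :&: P.
      apply/setP => v; rewrite !inE take_oversize ?size_s // sE !inE.
      by case: (~~ _) => //=; rewrite eqb_id.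
    have := cardsID P E; rewrite cE !cardsU1 !inE eqxx /=; lia.
  lia.
have [t [lS lUj]] := lU j; exists (l t) => //; split=> //.
by rewrite lUj.
Qed.

(** Take a dependence m with the wanted signs on S and add it to a multiple of l
    so large that l keeps deciding the signs outside S. *)
Lemma perturb_dependence l S X : #|S| = (d - 3)%N -> X \subset S -> dependence p l ->
  (forall v, (l v == 0) = (v \in S)) ->
  exists2 l', dependence p l' &
    forall v, if v \in [set v | 0 < l v] :|: X then 0 < l' v else l' v < 0.
Proof.
move=> cS XS dl lS.
have [T ST cT] : exists2 T : {set V}, S \subset T & #|T| = d.-1.
  have /card_gt1P[x [y [xS yS xy]]] : (1 < #|~: S|)%N.
    by have := cardsC S; rewrite cS cardV; lia.
  rewrite !inE in xS yS; exists (x |: (y |: S)); last exact: card_setU2.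
  by apply/subsetP => v vS; rewrite !inE vS !orbT.
have [m dm mT] := dependence_extend gp d0 cardV (fun v => if v \in X then 1 else -1) cT.
pose M := 1 + \sum_(v | v \notin S) `|m v| / `|l v|.
have lM v : v \notin S -> `|m v| < M * `|l v|.
  move=> vS; have lv : 0 < `|l v| by rewrite normr_gt0 lS.
  rewrite -ltr_pdivrMr // /M (bigD1 v) //=.
  have : 0 <= \sum_(i | (i \notin S) && (i != v)) `|m i| / `|l i|.
    by apply: sumr_ge0 => i _; rewrite divr_ge0.
  lra.
exists (fun v => M * l v + 1 * m v); first exact: dependence_comb.
move=> v; rewrite !inE mul1r.
have [vS|vS] := boolP (v \in S).
  have /eqP -> : l v == 0 by rewrite lS.
  rewrite ltxx mulr0 add0r mT ?(subsetP ST) //.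
  by case: (v \in X); rewrite ?ltr01 ?ltrN10.
rewrite (contraNF (subsetP XS v) vS) orbF.
have lv : l v != 0 by rewrite lS.
have := lM v vS.
have [l_gt0|l_le0] := ltrP 0 (l v).
  by rewrite (gtr0_norm l_gt0) ltr_norml => /andP[+ _]; lra.
by rewrite (ler0_norm l_le0) ltr_norml => /andP[_]; lra.
Qed.

End Halving.

(** * Relative interiors of simplices *)

Section RelativeInteriors.
Local Open Scope classical_set_scope.

Lemma convex_setE (R : realType) (M : lmodType R) (A : set M) :
  @convex_set R M A <->
  forall x y (t : R), 0 <= t <= 1 -> A x -> A y -> A (t *: x + (1 - t) *: y).
Proof.
split=> [cA x y t /andP[t0 t1] Ax Ay|cA x y t]; last first.
  rewrite !in_setE => Ax Ay; apply: (cA x y t%:num) => //.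
  by rewrite ge0 le1.
by have := cA x y (Itv01 t0 t1); rewrite !in_setE; apply.
Qed.

(** Convex sets are closed under binary combinations only, hence the induction;
    positive coefficients keep the partial sums invertible. *)
Lemma convex_comb (R : realType) (M : lmodType R) (V : eqType) (A : set M)
    (x : V -> M) (c : V -> R) (v : V) (s : seq V) :
  @convex_set R M A -> {in v :: s, forall w, A (x w) /\ 0 < c w} ->
  A ((\sum_(w <- v :: s) c w)^-1 *: \sum_(w <- v :: s) c w *: x w).
Proof.
move=> /convex_setE cA; elim: s v => [|w s IHs] v Axc.
  have [Av cv] := Axc v (mem_head _ _).
  by rewrite !big_seq1 scalerA mulVf ?scale1r // gt_eqF.
rewrite big_cons [X in _ *: X]big_cons.
have [Av cv] := Axc v (mem_head _ _).
have {}Axc : {in w :: s, forall w, A (x w) /\ 0 < c w}.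
  by move=> u us; apply: Axc; rewrite inE us orbT.
have {}IHs := IHs w Axc.
have : 0 < \sum_(w <- w :: s) c w.
  rewrite big_cons ltr_wpDr //; last by case: (Axc w (mem_head _ _)).
  rewrite big_seq sumr_ge0 // => u us; apply: ltW.
  by case: (Axc u) => //; rewrite inE us orbT.
move: IHs; set S := \sum_(_ <- _) _; set X := \sum_(_ <- _) _ => IHs S0.
have cS : 0 < c v + S by rewrite addr_gt0.
have -> : (c v + S)^-1 *: (c v *: x v + X) =
    (c v / (c v + S)) *: x v + (1 - c v / (c v + S)) *: (S^-1 *: X).
  rewrite scalerDr !scalerA; congr (_ *: _ + _ *: _); first by rewrite mulrC.
  by field; rewrite !gt_eqF.
apply: cA => //; apply/andP; split; first by rewrite divr_ge0 // ltW.
by rewrite ler_pdivrMr // mul1r lerDl ltW.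
Qed.

Section Simplices.
Variables (R : realType) (d : nat) (V : finType) (p : V -> 'rV[R]_d).
Hypothesis gp : general_position p.
Implicit Types (e f B : {set V}) (c : V -> R).

Lemma in_simplex e c : (forall v, v \in e -> 0 < c v) ->
  \sum_(v in e) c v = 1 -> simplex p e (\sum_(v in e) c v *: p v).
Proof.
move=> c0 c1.
have [e0|[v0 v0e]] := set_0Vmem e.
  by move: c1; rewrite e0 big_set0 => /esym/eqP; rewrite oner_eq0.
move=> A [cA pA]; move: c1; rewrite -!big_enum /=.
case E : (enum e) => [|v s] c1; first by move: v0e; rewrite -mem_enum E.
have := @convex_comb R _ _ A p c v s cA; rewrite c1 invr1 scale1r; apply.
move=> w; rewrite -E mem_enum => we; split; last exact: c0.
by apply: pA; exists w.
Qed.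

(** One equality of homogenized points records both the point and the fact that
    the coefficients add up to 1. *)
Lemma homog_sumP e c y :
  homog y = \sum_(v in e) c v *: homog (p v) <->
  \sum_(v in e) c v = 1 /\ y = \sum_(v in e) c v *: p v.
Proof.
have lE : lsubmx (\sum_(v in e) c v *: homog (p v)) = const_mx (\sum_(v in e) c v).
  rewrite linear_sum; apply/matrixP => i j; rewrite summxE mxE.
  by apply: eq_bigr => v _; rewrite linearZ /= row_mxKl !mxE mulr1.
have rE : rsubmx (\sum_(v in e) c v *: homog (p v)) = \sum_(v in e) c v *: p v.
  by rewrite linear_sum; apply: eq_bigr => v _; rewrite linearZ /= row_mxKr.
split=> [yE|[c1 yE]].
  split; last by rewrite -rE -yE row_mxKr.
  by move/matrixP: lE => /(_ 0 0); rewrite -yE row_mxKl !mxE => <-.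
by rewrite -[RHS]hsubmxK lE rE c1 -yE.
Qed.

Lemma near_barycentric (K : 'cV[R]_(1 + d)) x : 0 < (homog x *m K) 0 0 ->
  \forall y \near x, 0 < (homog y *m K) 0 0.
Proof.
have HE y : (homog y *m K) 0 0 = K 0 0 + \sum_(j < d) y 0 j * K (rshift 1 j) 0.
  rewrite mxE big_split_ord /= big_ord1 homogEl mul1r; congr (K _ _ + _).
    exact/val_inj.
  by apply: eq_bigr => j _; rewrite homogEr.
rewrite HE => Kx.
suff : nbhs x [set y : 'rV[R]_d |
    0 < K 0 0 + \sum_(j < d) y 0 j * K (rshift 1 j) 0]%classic.
  by apply: filterS => y /=; rewrite HE.
pose F j (y : 'rV[R]_d) : R := y 0 j * K (rshift 1 j) 0.
have cF j : F j @ x --> F j x.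
  apply: (@cvgM _ _ (nbhs x) _ (fun y : 'rV[R]_d => y 0 j) (fun=> K (rshift 1 j) 0)).
    exact: coord_continuous.
  exact: cvg_cst.
have add_cont : continuous (fun z : R * R => z.1 + z.2).
  by move=> z; apply: cvgD; [exact: cvg_fst|exact: cvg_snd].
have {}cF := @cvg_big _ _ _ 0 xpredT add_cont _ _ (index_enum 'I_d) _ _
  (nbhs_filter x) (fun j _ => cF j).
exact: (cvgr_gt _ (cvgD (cvg_cst (K 0 0)) cF) _ Kx).
Qed.

(** The barycentric coordinates with respect to an affine basis B containing e
    are affine and continuous.  Those outside e vanish on the affine hull of
    the simplex, and those in e, positive at the given point, stay positive
    near it. *)
Lemma relint_simplex e B c : e \subset B -> #|B| = d.+1 ->
  (forall v, v \in e -> 0 < c v) -> \sum_(v in e) c v = 1 ->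
  relative_interior (simplex p e) (\sum_(v in e) c v *: p v).
Proof.
move=> eB cB c0 c1; have [K [KE KS]] := barycentric_basis gp cB.
set x := \sum_(v in e) c v *: p v.
split; first exact: in_simplex.
have e_B v : v \in e -> v \in B by apply: subsetP.
(* The barycentric coordinates with respect to B. *)
pose z v y : R := (homog y *m K v) 0 0.
have z_affine v x1 y1 t : z v (t *: x1 + (1 - t) *: y1) = t * z v x1 + (1 - t) * z v y1.
  have hE : homog (t *: x1 + (1 - t) *: y1) = t *: homog x1 + (1 - t) *: homog y1.
    rewrite /homog !scale_row_mx add_row_mx; congr row_mx.
    by apply/matrixP => i j; rewrite !mxE; ring.
  by rewrite /z hE mulmxDl -!scalemxAl !mxE.
have z_vertex v w : v \in B -> w \in B -> z v (p w) = (v == w)%:R.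
  by move=> vB wB; apply: KE.
have homog_c : homog x = \sum_(v in e) c v *: homog (p v).
  exact/homog_sumP.
have zc v : v \in e -> z v x = c v.
  move=> ve; rewrite /z homog_c mulmx_suml summxE (bigD1 v) //= big1 ?addr0.
    by rewrite -scalemxAl mxE KE ?e_B // eqxx mulr1.
  move=> w /andP[we wv]; rewrite -scalemxAl mxE KE ?e_B //.
  by rewrite eq_sym (negPf wv) mulr0.
have z_hull y : affine_hull (simplex p e) y ->
    forall v, v \in B -> v \notin e -> z v y = 0.
  move=> hy v vB ve; move: y hy.
  have z_conv x1 y1 t : z v x1 = 0 -> z v y1 = 0 -> z v (t *: x1 + (1 - t) *: y1) = 0.
    by move=> x10 y10; rewrite z_affine x10 y10 !mulr0 addr0.
  apply: (@smallest_sub _ (@affine_set R _) _ [set y | z v y = 0]).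
    by move=> x1 y1 t; exact: z_conv.
  apply: (@smallest_sub _ (@convex_set R _) _ [set y | z v y = 0]).
    by apply/convex_setE => x1 y1 t _; exact: z_conv.
  move=> _ [w we <-] /=; have {}we : w \in e := we.
  have vw : v != w by apply: contraNneq ve => ->.
  by rewrite (z_vertex _ _ vB (e_B _ we)) (negPf vw).
have near_pos v : nbhs x [set y | v \in e -> 0 < z v y].
  have [ve|_] := boolP (v \in e); last first.
    by apply: (@filterE _ _ (nbhs_filter x)) => y.
  have := @near_barycentric (K v) x; rewrite -/(z v _) zc // => /(_ (c0 v ve)).
  by apply: filterS => y zy _.
rewrite /within /=; have := @filter_forall _ _ _ _ (nbhs_filter x) near_pos.
apply: filterS => y zy hy.
have homog_y : homog y = \sum_(v in e) z v y *: homog (p v).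
  rewrite -[LHS]KS (bigID (mem e)) /= [X in _ + X]big1 ?addr0.
    apply: eq_bigl => v; have [/e_B ->|_] := boolP (v \in e); by rewrite ?andbF.
  by move=> v /andP[vB ve]; rewrite -/(z v y) z_hull ?scale0r.
have /homog_sumP[z1 ->] := homog_y.
by apply: in_simplex => // v ve; exact: zy.
Qed.

End Simplices.

End RelativeInteriors.

(** * Counting crossing pairs *)

(** If s is the sum of the positive coefficients, then l / s on e and - l / s
    on the complement are the barycentric coordinates of the same point. *)
Lemma dependence_crossing (R : realType) (d : nat) (V : finType)
    (p : V -> 'rV[R]_d) (e : {set V}) (l : V -> R) :
  general_position p -> (0 < d)%N -> #|e| = d -> #|~: e| = d -> dependence p l ->
  (forall v, if v \in e then 0 < l v else l v < 0) -> crossing p e (~: e).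
Proof.
move=> gp d0 ce cf dl le; split.
  by rewrite disjoints_subset setCK.
have [u ue] : exists u, u \in e by apply/card_gt0P; rewrite ce.
have [w we] : exists w, w \in ~: e by apply/card_gt0P; rewrite cf.
have l_e v : v \in e -> 0 < l v by move=> ve; have := le v; rewrite ve.
have l_f v : v \in ~: e -> l v < 0.
  by rewrite in_setC => ve; have := le v; rewrite (negPf ve).
pose s := \sum_(v in e) l v.
have s0 : 0 < s.
  rewrite /s (bigD1 u) //= ltr_wpDr ?l_e // sumr_ge0 // => v /andP[ve _].
  exact/ltW/l_e.
pose x := \sum_(v in e) (l v / s) *: p v.
have c1 : \sum_(v in e) l v / s = 1 by rewrite -mulr_suml divff // gt_eqF.
have xE : homog x = \sum_(v in e) (l v / s) *: homog (p v) by exact/homog_sumP.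
have /homog_sumP[c'1 xE'] : homog x = \sum_(v in ~: e) (- l v / s) *: homog (p v).
  apply/eqP; rewrite xE -subr_eq0 -sumrN; apply/eqP.
  have := congr1 (fun z => s^-1 *: z) dl.
  rewrite scaler0 scaler_sumr (bigID (mem e)) /= => dl0.
  apply: etrans dl0; congr (_ + _).
    by apply: eq_bigr => v _; rewrite scalerA mulrC.
  apply: eq_big => v; first by rewrite in_setC.
  by move=> _; rewrite -scaleNr scalerA; congr (_ *: _); ring.
exists x; split.
  (* One vertex of the other side completes e to an affine basis. *)
  apply: (relint_simplex gp (B := w |: e)) => //; first exact: subsetUr.
    by rewrite in_setC in we; rewrite cardsU1 we ce.
  by move=> v ve; rewrite divr_gt0 ?l_e.
rewrite xE'; apply: (relint_simplex gp (B := u |: ~: e)) => //.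
- exact: subsetUr.
- by rewrite cardsU1 in_setC ue cf.
- by move=> v ve; rewrite divr_gt0 // oppr_gt0 l_f.
Qed.

Lemma general_position_comp (R : realType) (d : nat) (I V : finType)
    (p : V -> 'rV[R]_d) (g : I -> V) :
  injective g -> general_position p -> general_position (p \o g).
Proof.
move=> g_inj gp S cS [a [b [a0 abS]]].
apply: (gp (g @: S)); first by rewrite card_imset.
by exists a, b; split=> // _ /imsetP[i iS ->]; exact: abS.
Qed.

Lemma crossing_comp (R : realType) (d : nat) (I V : finType)
    (p : V -> 'rV[R]_d) (g : I -> V) (e f : {set I}) :
  injective g -> crossing (p \o g) e f -> crossing p (g @: e) (g @: f).
Proof.
move=> g_inj [ef].
have simplexE (A : {set I}) : simplex (p \o g) A = simplex p (g @: A).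
  congr (convex_hull _); apply/seteqP; split=> [_ [i iA <-]|_ [_ /imsetP[i iA ->] <-]].
    by exists (g i) => //; apply/imsetP; exists i.
  by exists i.
rewrite !simplexE; split=> //.
rewrite -setI_eq0 -imsetI; last by move=> *; exact: g_inj.
by rewrite imset_eq0 setI_eq0.
Qed.

(** The ordered version of the count: a crossing pair is counted twice, once for
    each of its two hyperedges. *)
Lemma many_balanced_crossings (R : realType) (d : nat) (q : 'I_(2 * d) -> 'rV[R]_d) :
  (100 <= d)%N -> general_position q ->
  (2 ^ d <= 64 * #|[set e : {set 'I_(2 * d)} |
                      (#|e| == d) && `[< crossing q e (~: e) >]]%SET|)%N.
Proof.
move=> d100 gq; have d3 : (3 <= d)%N by exact: leq_trans d100.
have cI : #|'I_(2 * d)| = (2 * d)%N by rewrite card_ord.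
apply: many_completions => // S cS.
have [l dl [lS cU]] := halving_dependence gq d3 cI cS.
pose U := [set v | 0 < l v]%SET.
have US : [disjoint U & S].
  rewrite disjoints_subset; apply/subsetP => v.
  rewrite in_setC !inE -lS => lv.
  by rewrite gt_eqF.
exists U => //; apply/subsetP => _ /imsetP[X + ->].
rewrite inE => /andP[XS /eqP cX].
have [l' dl' sgn] := perturb_dependence gq d3 cI cS XS dl lS.
have cUX : #|U :|: X| = d.
  rewrite cardsU cU cX disjoint_setI0 ?cards0; first by lia.
  exact: disjointWr XS US.
rewrite inE cUX eqxx; apply/asboolP.
apply: (@dependence_crossing _ _ _ q (U :|: X) l') => //; first by lia.
by have := cardsC (U :|: X); rewrite cUX cI; lia.
Qed.

(** The factor 128 is twice the 64 of the ordered count, as each unordered pair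
    covers two of the sets e. *)
Lemma crossings_on_subset (R : realType) (d : nat) (V : finType)
    (p : V -> 'rV[R]_d) (H : {set {set V}}) (W : {set V}) :
  (100 <= d)%N -> general_position p ->
  (forall e : {set V}, #|e| = d -> e \in H) -> #|W| = (2 * d)%N ->
  (2 ^ d <= 128 * #|[set P in crossing_pairs p H | cover P == W]%SET|)%N.
Proof.
move=> d100 gp HH cW.
pose g (i : 'I_(2 * d)) : V := enum_val (cast_ord (esym cW) i).
have g_inj : injective g by move=> i j /enum_val_inj/cast_ord_inj.
have gT : g @: setT = W.
  apply/eqP; rewrite eqEcard card_imset // cardsT card_ord cW leqnn andbT.
  by apply/subsetP => _ /imsetP[i _ ->]; exact: enum_valP.
have := many_balanced_crossings d100 (general_position_comp g_inj gp).
set good := finset _; set Q := finset _ => good_ge.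
have goodQ : [set g @: (e : {set 'I_(2 * d)}) | e in good]%SET \subset cover Q.
  apply/subsetP => _ /imsetP[e + ->]; rewrite inE => /andP[/eqP ce /asboolP cross].
  have cCe : #|~: e| = d by have := cardsC e; rewrite ce card_ord; lia.
  apply/bigcupP; exists [set g @: e; g @: (~: e)]%SET; last by rewrite !inE eqxx.
  rewrite !inE; apply/andP; split.
    apply/asboolP; exists (g @: e), (g @: (~: e)); split=> //.
    - by apply: HH; rewrite card_imset.
    - by apply: HH; rewrite card_imset.
    - exact: crossing_comp.
  by rewrite /cover bigcup_setU !big_set1 -imsetU setUCr gT.
have := subset_leq_card goodQ; rewrite card_imset; last exact: imset_inj.
move=> /leq_trans/(_ (leq_card_cover Q)).
have : (\sum_(A in Q) #|A| <= 2 * #|Q|)%N.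
  rewrite mulnC -sum_nat_const leq_sum // => P; rewrite inE => /andP[+ _].
  rewrite inE => /asboolP[e [f [_ _ -> _]]].
  by rewrite cards2; case: (_ != _).
lia.
Qed.

(** The pairs are grouped by the union of their two members, and only the groups
    whose union has 2d elements are kept. *)
Lemma card_crossing_pairs (R : realType) (d : nat) (V : finType)
    (p : V -> 'rV[R]_d) (H : {set {set V}}) :
  (100 <= d)%N -> general_position p -> (forall e : {set V}, #|e| = d -> e \in H) ->
  (2 ^ d * 'C(#|V|, 2 * d) <= 128 * #|crossing_pairs p H|)%N.
Proof.
move=> d100 gp HH.
rewrite -sum1_card (partition_big (@cover V) xpredT) //= big_distrr /=.
rewrite mulnC -card_draws -sum_nat_const.
rewrite [X in (_ <= X)%N](bigID (mem [set W : {set V} | #|W| == 2 * d]%SET)) /=.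
rewrite (leq_trans _ (leq_addr _ _)) // leq_sum // => W; rewrite inE => /eqP cW.
apply: leq_trans (crossings_on_subset d100 gp HH cW) _.
rewrite -sum1_card; apply/eq_leq; congr (128 * _)%N.
by apply: eq_bigl => P; rewrite inE.
Qed.

Theorem corollary1 (R : realType) :
  exists (C : R) (d0 : nat), 0 < C /\
    forall d n : nat, (2 <= d)%N -> (d0 <= d)%N -> (2 * d <= n)%N ->
      C * 2 ^+ d * 'C(n, 2 * d)%:R <=
        (rectilinear_crossing_number R d (complete_hypergraph d n))%:R.
Proof.
exists 128^-1, 100%N; split; first by rewrite invr_gt0.
move=> d n _ d100 _; rewrite /rectilinear_crossing_number.
case: ex_minnP => k /asboolP[p [gp <-]] _.
rewrite -mulrA ler_pdivrMl // -natrX -!natrM ler_nat.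
have := @card_crossing_pairs R d _ p (complete_hypergraph d n) d100 gp.
by rewrite card_ord; apply=> e ce; rewrite inE ce.
Qed.
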